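(* Let $K$ be a field, $J=\langle g_1,\ldots,g_\ell\rangle$ an ideal in $K[x]=K[x_1,\ldots,x_n]$, $R=K[x]/J$, $I=\langle h_1+J,\ldots,h_k+J\rangle$ an ideal of $R$ with $h_i\in K[x]$, and $\mathfrak{p}=\langle p_1+J,\ldots,p_m+J\rangle$ a prime ideal of $R$ with $p_i\in K[x]$. Let $S:=R\setminus\mathfrak{p}$ and $\mathfrak{q}:=\langle p_1,\ldots,p_m,g_1,\ldots,g_\ell\rangle\subseteq K[x]$. Consider the algorithm which, for $i=1,\ldots,k$, computes the normal form $\mathrm{NF}(h_i\mid\mathfrak{q})$ and returns $h_i+J$ as soon as $\mathrm{NF}(h_i\mid\mathfrak{q})\neq0$; if all these normal forms are $0$, it returns $0$. Then the output is an element of $I\cap S$ if $I\cap S\neq\emptyset$, and is $0$ if $I\cap S=\emptyset$.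
   Context: $\mathrm{NF}(h\mid\mathfrak{q})$ denotes the normal form of $h\in K[x]$ with respect to a Gröbner basis of the ideal $\mathfrak{q}$; in particular $\mathrm{NF}(h\mid\mathfrak{q})=0$ if and only if $h\in\mathfrak{q}$. *)

(* Defs.v *)
From HB Require Import structures.
From mathcomp Require Import all_boot all_order all_algebra.
From mathcomp Require Import boolp.
From mathcomp Require Export mpoly.

Set Implicit Arguments.
Unset Strict Implicit.
Unset Printing Implicit Defensive.

Import GRing.Theory.
Local Open Scope ring_scope.
Local Open Scope quotient_scope.

(* ------------------------------------------------------------------------ *)
(* Finitely generated and prime ideals.  The rings are possibly trivial     *)
(* ([comPzRingType]), so that K[x]/J makes sense for every ideal J; the     *)
(* ideals of [ring_quotient] are proper by definition.                      *)

Section Ideals.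
Variable A : comPzRingType.

Definition ideal_span (s : seq A) : {pred A} := fun x =>
  `[< exists c : 'I_(size s) -> A, x = \sum_(i < size s) c i * s`_i >].

Definition ideal_closed (P : {pred A}) : Prop :=
  0 \in P /\ forall a, {in P &, forall u v, a * u + v \in P}.

Definition prime_ideal (P : {pred A}) : Prop :=
  [/\ ideal_closed P, 1 \notin P &
      forall u v, u * v \in P -> u \in P \/ v \in P].

Lemma ideal_spanP s x :
  reflect (exists c : 'I_(size s) -> A, x = \sum_(i < size s) c i * s`_i)
          (x \in ideal_span s).
Proof. exact: asboolP. Qed.

Lemma ideal_span_closed s : ideal_closed (ideal_span s).
Proof.
split.
  apply/ideal_spanP; exists (fun _ => 0).
  by rewrite big1 // => i _; rewrite mul0r.
move=> a u v /ideal_spanP[c ->] /ideal_spanP[d ->].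
apply/ideal_spanP; exists (fun i => a * c i + d i).
rewrite mulr_sumr -big_split /=; apply: eq_bigr => i _.
by rewrite mulrDl mulrA.
Qed.

Lemma ideal_spanMl s a u : u \in ideal_span s -> a * u \in ideal_span s.
Proof.
have [s0 sD] := ideal_span_closed s.
by move=> us; rewrite -[a * u]addr0 sD.
Qed.

Lemma ideal_span_zmod_closed s : zmod_closed (ideal_span s).
Proof.
have [s0 sD] := ideal_span_closed s.
by split=> // x y xs ys; rewrite -mulN1r addrC sD.
Qed.

HB.instance Definition _ s :=
  GRing.isZmodClosed.Build A (ideal_span s) (ideal_span_zmod_closed s).

End Ideals.

(* ------------------------------------------------------------------------ *)
(* The quotient ring A / <g_1, ..., g_l>: the quotient group of             *)
(* [ring_quotient], with the induced product.  The class of x is            *)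
(* [\pi_(quot_ring g) x].                                                   *)

Section QuotientRing.
Variables (A : comPzRingType) (g : seq A).

Definition quot_ring : Type := {ideal_quot (ideal_span g)}.

HB.instance Definition _ := GRing.Zmodule.on quot_ring.
HB.instance Definition _ := EqQuotient.on quot_ring.
HB.instance Definition _ := ZmodQuotient.on quot_ring.

Definition quot_one : quot_ring := lift_cst quot_ring 1.
Definition quot_mul := lift_op2 quot_ring *%R.

Canonical pi_quot_one := PiConst quot_one.

Lemma pi_quot_mulM : {morph \pi_quot_ring : x y / x * y >-> quot_mul x y}.
Proof.
move=> x y; unlock quot_mul; apply/eqP; rewrite piE Quotient.equivE.
set x' := repr _; set y' := repr _.
have xE : x - x' \in ideal_span g by rewrite Quotient.idealrBE reprK.
have yE : y - y' \in ideal_span g by rewrite Quotient.idealrBE reprK.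
have -> : x * y - x' * y' = y * (x - x') + x' * (y - y').
  by rewrite !mulrBr addrA ![y * _]mulrC addrNK.
by rewrite rpredD ?ideal_spanMl.
Qed.
Canonical pi_quot_mul_morph := PiMorph2 pi_quot_mulM.

Lemma quot_mulA : associative quot_mul.
Proof. by move=> x y z; rewrite -[x]reprK -[y]reprK -[z]reprK !piE mulrA. Qed.

Lemma quot_mulC : commutative quot_mul.
Proof. by move=> x y; rewrite -[x]reprK -[y]reprK !piE mulrC. Qed.

Lemma quot_mul1 : left_id quot_one quot_mul.
Proof. by move=> x; rewrite -[x]reprK !piE mul1r. Qed.

Lemma quot_mulD : left_distributive quot_mul +%R.
Proof.
move=> x y z; rewrite -[x]reprK -[y]reprK -[z]reprK.
by rewrite !piE mulrDl.
Qed.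

HB.instance Definition _ := GRing.Zmodule_isComPzRing.Build quot_ring
  quot_mulA quot_mulC quot_mul1 quot_mulD.

End QuotientRing.

(* ------------------------------------------------------------------------ *)
(* Groebner bases and normal forms, for an arbitrary global monomial order. *)

Section NormalForm.
Variables (K : fieldType) (n : nat).
Variable le : rel 'X_{1..n}.

Definition monomial_order : Prop :=
  [/\ [/\ reflexive le, antisymmetric le, transitive le & total le],
      forall m1 m2 m : 'X_{1..n}, le m1 m2 -> le (m1 + m)%MM (m2 + m)%MM &
      forall m : 'X_{1..n}, le 0%MM m].

(* [mlead] of the multinomials library is for one fixed order; as there, the *)
(* leading monomial of 0 is 0%MM by convention.                              *)
Definition lead_mon (f : {mpoly K[n]}) : 'X_{1..n} :=
  \big[(fun m1 m2 => if le m1 m2 then m2 else m1)/0%MM]_(m <- msupp f) m.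

(* [(m1 <= m2)%MM] is divisibility of monomials. *)
Definition groebner_basis (P : {pred {mpoly K[n]}}) (G : seq {mpoly K[n]}) :=
  {subset G <= P} /\
  forall f, f \in P -> f != 0 ->
    exists2 g, g \in G & g != 0 /\ (lead_mon g <= lead_mon f)%MM.

(* The usual axioms for a normal form with respect to G: f - nf f has a      *)
(* standard representation, and the leading monomial of nf f is not in the   *)
(* leading ideal of G.  Tails need not be reduced, so reduced normal forms   *)
(* (remainders of complete division by G) are a special case.                *)
Definition normal_form (G : seq {mpoly K[n]})
    (nf : {mpoly K[n]} -> {mpoly K[n]}) : Prop :=
  [/\ nf 0 = 0,
      forall f, nf f != 0 ->
        {in G, forall g, g != 0 -> ~~ (lead_mon g <= lead_mon (nf f))%MM} &
      forall f, exists c : 'I_(size G) -> {mpoly K[n]},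
        f - nf f = \sum_(i < size G) c i * G`_i /\
        forall i : 'I_(size G),
          le (lead_mon (c i * G`_i)) (lead_mon (f - nf f))].

End NormalForm.

Fixpoint first_outside (K : fieldType) (n : nat)
    (nf : {mpoly K[n]} -> {mpoly K[n]}) (g h : seq {mpoly K[n]})
    : quot_ring g :=
  if h is h1 :: h' then
    if nf h1 != 0 then \pi_(quot_ring g) h1 else first_outside nf g h'
  else 0.

(* Main.v *)
Require Import Defs.
From mathcomp Require Import all_boot all_order all_algebra.
From mathcomp Require Import mpoly.

Local Open Scope ring_scope.
Local Open Scope quotient_scope.

Import GRing.Theory.

Set Implicit Arguments.
Unset Strict Implicit.

(** The ideal q is the preimage of P under the projection from K[x] to
    R = K[x]/J ([pi_ideal_span]), and a normal form vanishes exactly on its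
    ideal ([normal_form_eq0]).  So the test on h_i decides whether h_i + J
    lies in P, and the output is the first generator of I outside P, or 0 if
    there is none.  A generator outside P witnesses that I meets S; and if all
    generators lie in P then so does I, because P is an ideal, hence I does not
    meet S. *)

Lemma mem_ideal_span (A : comPzRingType) (s : seq A) :
  {subset s <= ideal_span s}.
Proof.
move=> x xs; have lt_xs : (index x s < size s)%N by rewrite index_mem.
apply/ideal_spanP; exists (fun i => (i == Ordinal lt_xs)%:R).
rewrite (bigD1 (Ordinal lt_xs)) //= eqxx mul1r nth_index //.
by rewrite big1 ?addr0 // => i /negPf->; rewrite mul0r.
Qed.

Lemma ideal_span_min (A : comPzRingType) (s : seq A) (P : {pred A}) :
  ideal_closed P -> {subset s <= P} -> {subset ideal_span s <= P}.
Proof.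
move=> [P0 PD] sP x /ideal_spanP[c ->].
elim/big_rec: _ => // i y _ Py.
by apply: PD Py; apply/sP/mem_nth.
Qed.

(** An ideal containing g is saturated for congruence modulo g, so it can be
    transported to the quotient by testing any representative. *)
Lemma mem_ideal_span_repr (A : comPzRingType) (p g : seq A) (f : A) :
  (repr (\pi_(quot_ring g) f) \in ideal_span (p ++ g))
    = (f \in ideal_span (p ++ g)).
Proof.
have g_sub : {subset ideal_span g <= ideal_span (p ++ g)}.
  apply: ideal_span_min; first exact: ideal_span_closed.
  by move=> x xg; apply: mem_ideal_span; rewrite mem_cat xg orbT.
have d_in : f - repr (\pi_(quot_ring g) f) \in ideal_span (p ++ g).
  by apply: g_sub; rewrite Quotient.idealrBE reprK.
by rewrite -{2}[f](subrK (repr (\pi_(quot_ring g) f))) rpredDl.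
Qed.

(** [pi_quot_mulM] stated with the ring product of the quotient, so that it can
    be used for rewriting. *)
Lemma pi_quotM (A : comPzRingType) (g : seq A) :
  {morph \pi_(quot_ring g) : x y / x * y}.
Proof. exact: pi_quot_mulM. Qed.

(** Both inclusions follow from minimality of a span: the elements whose
    representative lies in the ideal generated by p and g form an ideal of the
    quotient, and the preimage of an ideal of the quotient is an ideal of A
    containing g. *)
Lemma pi_ideal_span (A : comPzRingType) (p g : seq A) (f : A) :
  (\pi_(quot_ring g) f \in ideal_span [seq \pi_(quot_ring g) x | x <- p])
    = (f \in ideal_span (p ++ g)).
Proof.
set Pq := ideal_span (map _ p); have [Pq0 PqD] : ideal_closed Pq.
  exact: ideal_span_closed.
have [q0 qD] := ideal_span_closed (p ++ g).
apply/idP/idP => [fP|].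
  rewrite -mem_ideal_span_repr.
  pose Q : {pred quot_ring g} := [pred y | repr y \in ideal_span (p ++ g)].
  apply: (@ideal_span_min _ _ Q) fP; first split.
  - by rewrite inE -(raddf0 \pi_(quot_ring g)) mem_ideal_span_repr.
  - move=> a u v; rewrite !inE => uq vq.
    have -> : a * u + v = \pi_(quot_ring g) (repr a * repr u + repr v).
      by rewrite raddfD /= pi_quotM !reprK.
    by rewrite mem_ideal_span_repr; apply: qD.
  - move=> _ /mapP[x xp ->]; rewrite inE mem_ideal_span_repr.
    by apply: mem_ideal_span; rewrite mem_cat xp.
pose Q : {pred A} := [pred x | \pi_(quot_ring g) x \in Pq].
apply: (@ideal_span_min _ _ Q); first split.
- by rewrite inE raddf0.
- by move=> a u v; rewrite !inE => uP vP; rewrite raddfD /= pi_quotM; apply: PqD.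
move=> x; rewrite mem_cat inE => /orP[xp|xg].
  by apply: mem_ideal_span; apply: map_f.
have -> // : \pi_(quot_ring g) x = 0.
apply/eqP; rewrite -(raddf0 \pi_(quot_ring g)) -Quotient.idealrBE subr0.
exact: mem_ideal_span.
Qed.

(** As f - NF f lies in the ideal, f and NF f lie in it together.  A nonzero
    NF f in the ideal would have its leading monomial divisible by that of an
    element of the Groebner basis, against the irreducibility of NF f. *)
Lemma normal_form_eq0 (K : fieldType) (n : nat) (le : rel 'X_{1..n})
    (s G : seq {mpoly K[n]}) (NF : {mpoly K[n]} -> {mpoly K[n]}) f :
  groebner_basis le (ideal_span s) G -> normal_form le G NF ->
  (NF f == 0) = (f \in ideal_span s).
Proof.
move=> [Gs Glead] [_ NFirr NFspan].
have d_in : f - NF f \in ideal_span s.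
  apply: (ideal_span_min (ideal_span_closed s) Gs).
  by apply/ideal_spanP; have [c [fE _]] := NFspan f; exists c.
rewrite -[f in RHS](subrK (NF f)) rpredDl //.
apply/idP/idP => [/eqP->|NFs]; first exact: rpred0.
apply/negPn/negP => NF0; have [b bG [b0 b_dvd]] := Glead _ NFs NF0.
by have /negP := NFirr f NF0 b bG b0.
Qed.

Variant first_outside_spec (K : fieldType) (n : nat)
    (NF : {mpoly K[n]} -> {mpoly K[n]}) (g h : seq {mpoly K[n]}) :
    quot_ring g -> Prop :=
  | FirstOutsideSome f of f \in h & NF f != 0 :
      first_outside_spec NF h (\pi_(quot_ring g) f)
  | FirstOutsideNone of (forall f, f \in h -> NF f = 0) :
      first_outside_spec NF h 0.

Lemma first_outsideP (K : fieldType) (n : nat)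
    (NF : {mpoly K[n]} -> {mpoly K[n]}) (g h : seq {mpoly K[n]}) :
  first_outside_spec NF h (first_outside NF g h).
Proof.
elim: h => [|f h IHh] /=; first by right.
case: eqVneq => [NFf|NFf] /=; last by left; rewrite ?mem_head.
case: IHh => [f' f'h NFf'|NFh]; first by left; rewrite // inE f'h orbT.
by right=> f'; rewrite inE => /predU1P[->|/NFh].
Qed.

Unset Implicit Arguments.

Theorem mainTheorem8 (K : fieldType) (n : nat) (g h p : seq {mpoly K[n]})
    (le : rel 'X_{1..n}) (G : seq {mpoly K[n]})
    (NF : {mpoly K[n]} -> {mpoly K[n]}) :
  let R : comPzRingType := quot_ring g in
  let I : {pred R} := ideal_span [seq \pi_(quot_ring g) f | f <- h] in
  let P : {pred R} := ideal_span [seq \pi_(quot_ring g) f | f <- p] in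
  let S : {pred R} := [predC P] in
  let q : {pred {mpoly K[n]}} := ideal_span (p ++ g) in
  let output : R := first_outside NF g h in
  prime_ideal P ->
  monomial_order le -> groebner_basis le q G -> normal_form le G NF ->
  ((exists x : R, x \in [predI I & S]) -> output \in [predI I & S]) /\
  (~ (exists x : R, x \in [predI I & S]) -> output = 0).
Proof.
move=> R I P S q output _ _ Gq GNF.
have NF_P f : (NF f == 0) = (\pi_(quot_ring g) f \in P).
  by rewrite (normal_form_eq0 f Gq GNF) pi_ideal_span.
rewrite /output; case: first_outsideP => [f fh NFf|NFh].
  have fIS : \pi_(quot_ring g) f \in [predI I & S].
    apply/andP; split; last by rewrite /S !inE -NF_P.
    by apply: mem_ideal_span; apply: map_f.
  by split=> // nIS; case: nIS; exists (\pi_(quot_ring g) f).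
split=> // -[x /andP[xI /negP[]]].
apply: ideal_span_min xI; first exact: ideal_span_closed.
by move=> _ /mapP[f fh ->]; rewrite -NF_P NFh.
Qed.
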